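(* Let $h>0$ and let $p\ge 2$ be an integer. Assume condition (H): the parameter $\beta>0$ is smaller than the constant $\beta_p$ defined by $8p^2\beta_p^2\exp(16\beta_p^2p)=\frac12$. Then the equation $$q=\mathbf E\Big[\tanh^2\Big(\beta\big(\tfrac p2\big)^{1/2}q^{\frac{p-1}{2}}\,Y+h\Big)\Big],$$ where $Y$ is a standard Gaussian random variable, has a unique solution $q_p$ in $[0,1]$. Moreover, $$\lim_{p\to\infty}q_p=\tanh^2(h).$$
   Context: $\mathbf E$ denotes expectation. The setting is the $p$-spin interaction spin glass model, where $p$ is the number of interacting spins, $\beta$ is the inverse temperature and $h$ is the strictly positive external magnetic field. $q_p$ denotes the solution of the displayed equation for the given $p$ (with parameters $\beta$ and $h$). *)

(* Defs.v *)
From HB Require Import structures.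
From mathcomp Require Import all_boot all_order all_algebra.
From mathcomp Require Import all_classical all_reals all_analysis.

Set Implicit Arguments.
Unset Strict Implicit.
Unset Printing Implicit Defensive.

Import Order.TTheory GRing.Theory Num.Theory.
Import numFieldNormedType.Exports.

Local Open Scope classical_set_scope.
Local Open Scope ring_scope.

Definition tanh (R : realType) (x : R) : R :=
  (expR x - expR (- x)) / (expR x + expR (- x)).

Definition standard_gaussian (R : realType) (d : measure_display)
    (T : measurableType d) (P : probability T R) (Y : {RV P >-> R}) : Prop :=
  forall A : set R, measurable A -> distribution P Y A = normal_prob 0 1 A.

(* The sign condition is needed: the equation is even in [b]. *)
Definition is_beta_threshold (R : realType) (p : nat) (b : R) : Prop :=
  0 < b /\
  8 * p%:R ^+ 2 * b ^+ 2 * expR (16 * b ^+ 2 * p%:R) = 2^-1.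

Lemma beta_threshold_exists_unique (R : realType) (p : nat) :
  (2 <= p)%N -> exists! b : R, is_beta_threshold p b.
Proof.
move=> p2; have p1 : 1 <= p%:R :> R by rewrite ler1n ltnW.
have p0 : 0 < p%:R :> R by exact: lt_le_trans p1.
pose f (b : R) : R := 8 * p%:R ^+ 2 * b ^+ 2 * expR (16 * b ^+ 2 * p%:R).
have f_incr (x y : R) : 0 < x -> x < y -> f x < f y.
  move=> x0 xy; have xy2 : x ^+ 2 < y ^+ 2.
    by rewrite ltr_pXn2r// nnegrE ltW// (lt_trans x0).
  apply: ltr_pM; rewrite ?expR_ge0//.
  - by rewrite !mulr_ge0// ?sqr_ge0// ltW.
  - by rewrite ltr_pM2l// mulr_gt0// exprn_gt0.
  - by rewrite ltr_expR ltr_pM2r// ltr_pM2l.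
have f0 : f 0 = 0 by rewrite /f expr0n/= mulr0 mul0r.
have f1 : 1 <= f 1.
  rewrite /f expr1n !mulr1 -[leLHS]mulr1; apply: ler_pM => //.
    rewrite -[leLHS]mulr1; apply: ler_pM => //; first by rewrite ler1n.
    by rewrite exprn_ege1.
  by rewrite -expR0 ler_expR mulr_ge0// ltW.
have f_cont : continuous f.
  move=> x; apply: cvgM.
    by apply: cvgM; [exact: cvg_cst|exact: exprn_continuous].
  apply: continuous_comp; last exact: continuous_expR.
  apply: cvgM; last exact: cvg_cst.
  by apply: cvgM; [exact: cvg_cst|exact: exprn_continuous].
have half0 : 0 < 2^-1 :> R by rewrite invr_gt0.
have half1 : 2^-1 <= 1 :> R by rewrite invf_le1 ?ler1n.
have [b /itvP b01 fb] : exists2 b : R, b \in `[0, 1] & f b = 2^-1.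
  apply: IVT => //; first exact: continuous_subspaceT.
  have f01 : f 0 <= f 1 by rewrite f0 (le_trans _ f1).
  by rewrite (min_idPl f01) (max_idPr f01) f0 ltW//= (le_trans half1).
have b0 : 0 < b.
  rewrite lt_neqAle b01 andbT; apply/eqP => b_eq0.
  by move: half0; rewrite -fb -b_eq0 f0 ltxx.
exists b; split=> // c [c0 fc].
case: (ltgtP b c) => // [bc|cb].
- by have := f_incr _ _ b0 bc; rewrite fb /f fc ltxx.
- by have := f_incr _ _ c0 cb; rewrite fb /f fc ltxx.
Qed.

Definition condition_H (R : realType) (p : nat) (beta : R) : Prop :=
  0 < beta /\ exists2 bp : R, is_beta_threshold p bp & beta < bp.

Definition overlap_solution (R : realType) (d : measure_display)
    (T : measurableType d) (P : probability T R) (Y : {RV P >-> R})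
    (h : R) (p : nat) (beta q : R) : Prop :=
  0 <= q <= 1 /\
  q%:E = ('E_P[(fun w : T =>
    tanh (beta * (p%:R / 2) `^ 2^-1 * q `^ ((p%:R - 1) / 2) * Y w + h) ^+ 2)%R])%E.

(* Main.v *)
Require Import Defs.
From HB Require Import structures.
From mathcomp Require Import all_boot all_order all_algebra.
From mathcomp Require Import all_classical all_reals all_analysis.
From mathcomp Require Import measurable_realfun.
From mathcomp Require Import ring lra.

Set Implicit Arguments.
Unset Strict Implicit.
Unset Printing Implicit Defensive.

Import Order.TTheory GRing.Theory Num.Theory.
Import numFieldNormedType.Exports.

Local Open Scope classical_set_scope.
Local Open Scope ring_scope.

(* Put psi(s) = E[tanh^2(s Y + h)]. As Y and - Y have the same law, 2 psi(s) is
   the expectation of G(s Y) with G(x) = tanh^2(h + x) + tanh^2(h - x). Since G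
   is even with bounded second derivative, |G(a) - G(b)| <= 8 |a^2 - b^2|, so,
   with E[Y^2] <= 6, |psi(s) - psi(t)| <= 24 |s^2 - t^2|. The equation reads
   q = psi(s(q)) with s(q)^2 = beta^2 (p / 2) q^(p - 1), and (H) gives
   beta^2 p^2 < 1/16: its right-hand side is therefore a 3/4-contraction of
   [0, 1]. Moreover a solution q satisfies
   |q - tanh^2 h| = |psi(s(q)) - psi(0)| <= 24 s(q)^2 <= 24 / (32 p). *)

(** The derivative is bounded on [[a, b]] only, so [k] may depend on the endpoints;
    [tanh_sqr_sym_sub] takes [k = 8 * a]. *)
Lemma MVT_norm_le (R : realType) (f df : R -> R) (k a b : R) :
    (forall x : R, is_derive x 1 f (df x)) -> a <= b ->
    (forall x, a <= x <= b -> `|df x| <= k) ->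
  `|f b - f a| <= k * (b - a).
Proof.
move=> fdf ab dfk; have [c cab ->] : exists2 c, c \in `[a, b] &
    f b - f a = df c * (b - a).
  apply: MVT_segment => //; apply: derivable_within_continuous => x _.
  by have [] := fdf x.
rewrite normrM (ger0_norm (_ : 0 <= b - a)) ?subr_ge0//.
by rewrite ler_wpM2r ?subr_ge0// dfk// -in_itv.
Qed.

(** * Derivatives and Lipschitz bounds for the squared hyperbolic tangent *)

Section tanh_square.
Context {R : realType}.
Implicit Types x y a b h : R.

Lemma tanh_norm_le1 x : `|tanh x| <= 1.
Proof.
have ex := expR_gt0 x; have eNx := expR_gt0 (- x).
rewrite /tanh normrM normfV.
rewrite (ger0_norm (_ : 0 <= expR x + expR (- x))); last lra.
rewrite ler_pdivrMr; last lra.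
by rewrite ler_norml; apply/andP; split; lra.
Qed.

Lemma tanh_sqr_le1 x : tanh x ^+ 2 <= 1.
Proof. by rewrite -real_normK ?num_real// expr_le1// tanh_norm_le1. Qed.

Lemma is_derive_tanh x : is_derive x 1 (@tanh R) (1 - tanh x ^+ 2).
Proof.
have ex := expR_gt0 x; have eNx := expR_gt0 (- x).
have d0 : expR x + expR (- x) != 0 by rewrite gt_eqF// addr_gt0.
have dexp := is_derive_expR x.
have dexpN : is_derive x 1 (expR \o -%R) (expR (- x) * -1).
  exact: is_derive1_comp.
have := is_deriveM (is_deriveB dexp dexpN)
  (is_deriveV (f := expR + (expR \o -%R)) d0 (is_deriveD dexp dexpN)).
rewrite [X in is_derive _ _ X _](_ : _ = @tanh R)//.
move=> /is_derive_eq; apply.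
rewrite /tanh !fctE/= /GRing.scale/=.
by field.
Qed.

Definition tanh_sqr_deriv x := 2 * tanh x * (1 - tanh x ^+ 2).

Lemma is_derive_tanh_sqr x :
  is_derive x 1 (fun y => tanh y ^+ 2) (tanh_sqr_deriv x).
Proof.
have := is_deriveX 2 (is_derive_tanh x).
move=> /is_derive_eq; apply.
by rewrite /GRing.scale/= expr1.
Qed.

(** With [t = tanh x ^+ 2] in [[0, 1]], the second derivative [2 (1 - t) (1 - 3 t)] has
    [|1 - t| <= 1] and [|1 - 3 t| <= 2], whence the constant 4. *)
Lemma tanh_sqr_deriv_lipschitz a b : a <= b ->
  `|tanh_sqr_deriv b - tanh_sqr_deriv a| <= 4 * (b - a).
Proof.
pose df x : R := 2 * (1 - tanh x ^+ 2) * (1 - 3 * tanh x ^+ 2).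
have dfP x : is_derive x 1 tanh_sqr_deriv (df x).
  have dt := is_derive_tanh x.
  have := is_deriveM (is_deriveM (is_derive_cst (2 : R) x 1) dt)
    (is_deriveB (is_derive_cst (1 : R) x 1) (is_deriveX 2 dt)).
  move=> /is_derive_eq; apply.
  by rewrite /df /GRing.scale/= !fctE/=; ring.
move=> ab; apply: (MVT_norm_le dfP ab) => x _.
rewrite /df; have := tanh_sqr_le1 x; have := sqr_ge0 (tanh x).
set t := tanh x ^+ 2 => t0 t1.
by rewrite ler_norml; apply/andP; split; nra.
Qed.

Definition tanh_sqr_sym h x := tanh (h + x) ^+ 2 + tanh (h - x) ^+ 2.

(* The symmetrization is even and its derivative is Lipschitz, hence it is
   Lipschitz as a function of the square of its argument. *)
Lemma tanh_sqr_sym_sub h a b :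
  `|tanh_sqr_sym h a - tanh_sqr_sym h b| <= 8 * `|a ^+ 2 - b ^+ 2|.
Proof.
have even x : tanh_sqr_sym h `|x| = tanh_sqr_sym h x.
  have [x0|x0] := leP 0 x; first by rewrite ger0_norm.
  by rewrite ltr0_norm// /tanh_sqr_sym opprK addrC.
rewrite -(even a) -(even b).
rewrite -(real_normK (num_real a)) -(real_normK (num_real b)).
have := normr_ge0 a; have := normr_ge0 b.
move: `|a| `|b| => {}a {}b.
wlog ba : a b / b <= a.
  move=> H b0 a0; have [ba|/ltW ab] := leP b a; first exact: H.
  by rewrite distrC (distrC (a ^+ 2)) H.
move=> b0 a0.
pose dg x := tanh_sqr_deriv (h + x) - tanh_sqr_deriv (h - x).
have dgP x : is_derive x 1 (tanh_sqr_sym h) (dg x).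
  have d1 : is_derive x 1 (fun y => h + y) 1.
    have := is_deriveD (is_derive_cst h x 1) (is_derive_id x 1).
    by move=> /is_derive_eq; apply; rewrite add0r.
  have d2 : is_derive x 1 (fun y => h - y) (-1).
    have := is_deriveB (is_derive_cst h x 1) (is_derive_id x 1).
    by move=> /is_derive_eq; apply; rewrite sub0r.
  have := is_deriveD
    (is_derive1_comp (g := fun y => h + y) (is_derive_tanh_sqr (h + x)) d1)
    (is_derive1_comp (g := fun y => h - y) (is_derive_tanh_sqr (h - x)) d2).
  by move=> /is_derive_eq; apply; rewrite /dg mulr1 mulrN1.
(* For [x] in [[b, a]], [dg x] is the increment of [tanh_sqr_deriv] over a segment of length [2 x],
   so [|dg x| <= 8 x <= 8 a]. Then [a <= a + b] turns [8 a (a - b)] into [8 (a^2 - b^2)]. *)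
have : `|tanh_sqr_sym h a - tanh_sqr_sym h b| <= 8 * a * (a - b).
  apply: (MVT_norm_le dgP) => // x /andP[bx xa].
  have hx : h - x <= h + x by lra.
  by apply: (le_trans (tanh_sqr_deriv_lipschitz hx)); lra.
move=> /le_trans; apply.
by rewrite ger0_norm; nra.
Qed.

End tanh_square.

(** * Integrals against the normal law: density, symmetry, second moment *)

Section normal_integrals.
Context {R : realType}.
Local Notation mu := (@lebesgue_measure R).

(** With [u = 3 x^2 / 8], the density of standard deviation 1 is [2 exp(- u)] times that of standard
    deviation 2, and [u exp(- u) <= 1]. A multiple of a density thus dominates the second-moment
    integrand. *)
Lemma sqr_normal_pdf_le (x : R) :
  x ^+ 2 * normal_pdf 0 1 x <= 16 / 3 * normal_pdf 0 2 x.
Proof.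
rewrite !normal_pdfE ?oner_eq0 ?pnatr_eq0//.
have -> : normal_peak 2 = normal_peak 1 / 2 :> R.
  rewrite /normal_peak expr1n mul1r -mulrnAr sqrtrM ?sqr_ge0//.
  by rewrite sqrtr_sqr ger0_norm// invfM mulrC.
have -> : normal_fun 0 1 x = (expR (3 / 8 * x ^+ 2))^-1 * normal_fun 0 2 x.
  by rewrite /normal_fun -expRN -expRD; congr expR; field.
have pk := normal_peak_ge0 (1 : R); have nf := normal_fun_ge0 0 (2 : R) x.
have c0 : 0 <= 8 / 3 * (normal_peak 1 * normal_fun 0 2 x).
  by rewrite mulr_ge0// mulr_ge0.
rewrite [leLHS](_ : _ = 8 / 3 * (normal_peak 1 * normal_fun 0 2 x) *
  ((3 / 8 * x ^+ 2) / expR (3 / 8 * x ^+ 2))); last first.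
  by field; rewrite gt_eqF// expR_gt0.
rewrite [leRHS](_ : _ = 8 / 3 * (normal_peak 1 * normal_fun 0 2 x) * 1);
  last by field.
rewrite ler_wpM2l// ler_pdivrMr ?expR_gt0// mul1r.
by have := expR_ge1Dx (3 / 8 * x ^+ 2); lra.
Qed.

Local Open Scope ereal_scope.

(** The Radon-Nikodym derivative of the normal law and [normal_pdf] have the same integral over
    every measurable set, so they agree almost everywhere. *)
Lemma ge0_integral_normal_prob (m s : R) (f : R -> \bar R) :
    measurable_fun [set: R] f -> (forall x, 0 <= f x) ->
  \int[normal_prob m s]_x f x = \int[mu]_x (f x * (normal_pdf m s x)%:E).
Proof.
move=> mf f0; have dom := normal_prob_dominates m s.
rewrite -(Radon_Nikodym_SigmaFinite.change_of_variables dom f0)//.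
have mpdf : measurable_fun setT (fun x => (normal_pdf m s x)%:E).
  by apply/measurable_EFinP; exact: measurable_normal_pdf.
have iRN := Radon_Nikodym_SigmaFinite.f_integrable dom.
apply: ae_eq_integral => //.
- by apply: emeasurable_funM => //; exact: measurable_int iRN.
- exact: emeasurable_funM.
- apply: ae_eqe_mul2l; apply: integral_ae_eq => // E _ mE.
  by rewrite -(Radon_Nikodym_SigmaFinite.f_integral dom).
Qed.

Lemma ge0_integral_lebesgueN (f : R -> \bar R) :
    measurable_fun [set: R] f -> (forall x, 0 <= f x) ->
  \int[mu]_x f (- x)%R = \int[mu]_x f x.
Proof.
move=> mf f0.
transitivity (\int[pushforward mu (-%R : _ -> measurableTypeR R)]_x f x).
  by rewrite ge0_integral_pushforward.
by apply: eq_measure_integral => A mA _; exact: lebesgue_measureN.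
Qed.

Lemma ge0_integral_normal_probN (s : R) (f : R -> \bar R) : s != 0%R ->
    measurable_fun [set: R] f -> (forall x, 0 <= f x) ->
  \int[normal_prob 0 s]_x f (- x)%R = \int[normal_prob 0 s]_x f x.
Proof.
move=> s0 mf f0.
have mpdf : measurable_fun [set: R] (fun x => (normal_pdf 0 s x)%:E).
  by apply/measurable_EFinP; exact: measurable_normal_pdf.
have evenpdf x : normal_pdf 0 s (- x) = normal_pdf 0 s x :> R.
  by rewrite !normal_pdfE// /normal_fun !subr0 sqrrN.
rewrite !ge0_integral_normal_prob//; last exact: measurableT_comp.
rewrite -[RHS]ge0_integral_lebesgueN.
- by apply: eq_integral => x _; rewrite evenpdf.
- exact: emeasurable_funM.
- by move=> x; rewrite mule_ge0// lee_fin normal_pdf_ge0.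
Qed.

(** A crude bound suffices: domination by [16 / 3] times a density of total mass 1 avoids computing
    the moment. *)
Lemma normal_second_moment_le :
  \int[normal_prob 0 1]_x (x ^+ 2)%:E <= (6 : R)%:E.
Proof.
rewrite ge0_integral_normal_prob//; last 2 first.
  by apply/measurable_EFinP; exact: exprn_measurable.
  by move=> x; rewrite lee_fin sqr_ge0.
apply: (@le_trans _ _ (\int[mu]_x ((16 / 3)%:E * (normal_pdf 0 2 x)%:E))).
  apply: ge0_le_integral => //=.
  - by move=> x _; rewrite -EFinM lee_fin mulr_ge0// ?sqr_ge0// normal_pdf_ge0.
  - apply: emeasurable_funM; apply/measurable_EFinP.
      exact: exprn_measurable.
    exact: measurable_normal_pdf.
  - apply: emeasurable_funM => //; apply/measurable_EFinP.
    exact: measurable_normal_pdf.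
  - by move=> x _; rewrite -!EFinM lee_fin sqr_normal_pdf_le.
rewrite integralZl//; last exact: integrable_normal_pdf.
rewrite integral_normal_pdf mule1 lee_fin; lra.
Qed.

End normal_integrals.

(** * The expectation as a function of the coefficient of the Gaussian *)

Section gaussian_expectation.
Context {R : realType} {d : measure_display} {T : measurableType d}.
Context (P : probability T R) (Y : {RV P >-> R}) (hY : standard_gaussian Y).

Let ge0_integral_standard_gaussian (f : R -> \bar R) :
    measurable_fun [set: R] f -> (forall x, 0 <= f x)%E ->
  (\int[P]_w f (Y w) = \int[normal_prob 0 1]_x f x)%E.
Proof.
move=> mf f0.
(* [normal_prob] lives on [measurableTypeR R], whose display differs from
   that of [R] although the measurable sets are the same. *)
pose Y' : T -> measurableTypeR R := Y.
have mY' : measurable_fun setT Y'.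
  by move=> mT A mA; exact: (measurable_funP Y mT A mA).
transitivity (\int[pushforward P Y']_y f y)%E.
  by rewrite ge0_integral_pushforward.
by apply: eq_measure_integral => A mA _; exact: hY.
Qed.

Let measurable_tanh_sqr_affine h s :
  measurable_fun [set: R] (fun y => tanh (s * y + h) ^+ 2).
Proof.
apply: measurable_funX; apply: (@measurableT_comp _ _ _ _ _ _ (@tanh R)).
  apply: continuous_measurable_fun => x; apply/differentiable_continuous.
  by apply/derivable1_diffP; have [] := is_derive_tanh x.
by apply: measurable_funD => //; exact: measurable_funM.
Qed.

Let measurable_tanh_sqr_gaussian h s :
  measurable_fun [set: T] (fun w => tanh (s * Y w + h) ^+ 2).
Proof.
exact: (measurableT_comp (measurable_tanh_sqr_affine h s)).
Qed.

Let integrable_tanh_sqr_gaussian h s :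
  P.-integrable setT (EFin \o (fun w => tanh (s * Y w + h) ^+ 2)).
Proof.
apply: measurable_bounded_integrable => //.
  by move: (ltry (1 : R)); rewrite -(probability_setT P).
exists 1; split => // M M1 w _ /=.
by rewrite ger0_norm ?sqr_ge0// (le_trans (tanh_sqr_le1 _))// ltW.
Qed.

Definition gaussian_tanh_sqr h s : R := \int[P]_w (tanh (s * Y w + h) ^+ 2).

(** Boundedness of the integrand makes the extended-real expectation finite, so the equation for [q]
    becomes one between reals. *)
Lemma expectation_tanh_sqr h s :
  ('E_P[(fun w => tanh (s * Y w + h) ^+ 2)%R] = (gaussian_tanh_sqr h s)%:E)%E.
Proof.
rewrite unlock /gaussian_tanh_sqr /Rintegral fineK//.
exact: (integrable_fin_num measurableT (integrable_tanh_sqr_gaussian h s)).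
Qed.

Lemma gaussian_tanh_sqr_itv h s : 0 <= gaussian_tanh_sqr h s <= 1.
Proof.
apply/andP; split; first by apply: Rintegral_ge0 => w _; exact: sqr_ge0.
have <- : \int[P]_w (1 : R) = 1.
  by rewrite Rintegral_cst//= probability_setT mulr1.
apply: le_Rintegral => //.
  by apply: finite_measure_integrable_cst.
by move=> w _; exact: tanh_sqr_le1.
Qed.

Lemma gaussian_tanh_sqr0 h : gaussian_tanh_sqr h 0 = tanh h ^+ 2.
Proof.
rewrite /gaussian_tanh_sqr; under eq_Rintegral do rewrite mul0r add0r.
by rewrite Rintegral_cst//= probability_setT mulr1.
Qed.

Let gaussian_tanh_sqrN h s : gaussian_tanh_sqr h (- s) = gaussian_tanh_sqr h s.
Proof.
rewrite /gaussian_tanh_sqr /Rintegral; congr fine.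
have mf := measurable_tanh_sqr_affine h.
rewrite (ge0_integral_standard_gaussian
  (f := fun y => (tanh (- s * y + h) ^+ 2)%:E)).
- rewrite (ge0_integral_standard_gaussian
    (f := fun y => (tanh (s * y + h) ^+ 2)%:E)).
  + rewrite -[RHS]ge0_integral_normal_probN ?oner_eq0//.
    * by apply: eq_integral => x _; rewrite mulrN mulNr.
    * exact/measurable_EFinP.
    * by move=> x; rewrite lee_fin sqr_ge0.
  + exact/measurable_EFinP.
  + by move=> x; rewrite lee_fin sqr_ge0.
- exact/measurable_EFinP.
- by move=> x; rewrite lee_fin sqr_ge0.
Qed.

Let gaussian_second_moment :
  P.-integrable setT (fun w => (Y w ^+ 2)%:E) /\ \int[P]_w (Y w ^+ 2) <= 6.
Proof.
have m2 : (\int[P]_w (Y w ^+ 2)%:E <= 6%:E)%E.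
  rewrite (ge0_integral_standard_gaussian (f := fun y => (y ^+ 2)%:E)).
  - exact: normal_second_moment_le.
  - by apply/measurable_EFinP; exact: exprn_measurable.
  - by move=> x; rewrite lee_fin sqr_ge0.
have i2 : P.-integrable setT (fun w => (Y w ^+ 2)%:E).
  apply/integrableP; split.
    by apply/measurable_EFinP; exact: measurable_funX.
  under eq_integral do rewrite gee0_abs ?lee_fin ?sqr_ge0//.
  by rewrite (le_lt_trans m2)// ltry.
by split => //; rewrite /Rintegral -lee_fin fineK// integrable_fin_num.
Qed.

(** The pointwise bound of [tanh_sqr_sym_sub] at [s Y] and [t Y] integrates to [8 * 6 * |s^2 - t^2|]
    for the doubled expectations; halving gives 24. *)
Lemma gaussian_tanh_sqr_sub h s t :
  `|gaussian_tanh_sqr h s - gaussian_tanh_sqr h t| <= 24 * `|s ^+ 2 - t ^+ 2|.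
Proof.
have [i2 m2] := gaussian_second_moment.
have I u := integrable_tanh_sqr_gaussian h u.
have I2 u : P.-integrable setT
    (EFin \o (fun w => tanh (h + u * Y w) ^+ 2 + tanh (h - u * Y w) ^+ 2)).
  apply: eq_integrable (integrableD measurableT (I u) (I (- u))) => // w _.
  by rewrite /= mulNr !(addrC h).
(* One of the two copies is replaced by its value at [- u], which brings the symmetrized function
   under the integral. *)
have sym u : gaussian_tanh_sqr h u * 2 =
    \int[P]_w (tanh (h + u * Y w) ^+ 2 + tanh (h - u * Y w) ^+ 2).
  rewrite mulr_natr mulr2n -[X in _ + X = _]gaussian_tanh_sqrN -RintegralD//.
  by apply: eq_Rintegral => w _; rewrite mulNr !(addrC h).
suff : `|gaussian_tanh_sqr h s * 2 - gaussian_tanh_sqr h t * 2| <=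
    8 * `|s ^+ 2 - t ^+ 2| * 6.
  by rewrite -mulrBl normrM (ger0_norm (ler0n _ 2)); lra.
rewrite !sym -RintegralB//.
have ID := integrableB measurableT (I2 s) (I2 t).
apply: (le_trans (le_normr_Rintegral measurableT ID)).
apply: (@le_trans _ _ (\int[P]_w (8 * `|s ^+ 2 - t ^+ 2| * Y w ^+ 2))).
  apply: le_Rintegral => //.
  - exact: (integrable_norm ID).
  - exact: (integrableZl measurableT (8 * `|s ^+ 2 - t ^+ 2|) i2).
  - move=> w _; apply: (le_trans (tanh_sqr_sym_sub h _ _)).
    by rewrite !exprMn -mulrBl normrM (ger0_norm (sqr_ge0 (Y w))) mulrA.
rewrite RintegralZl//.
by rewrite ler_wpM2l// mulr_ge0.
Qed.

End gaussian_expectation.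

(** * Contractions of the unit interval *)

Section fixed_point.
Context {R : realType}.
Implicit Types a b p q : R.

Lemma expr_sub_le n a b : 0 <= a <= 1 -> 0 <= b <= 1 ->
  `|a ^+ n - b ^+ n| <= n%:R * `|a - b|.
Proof.
move=> /andP[a0 a1] /andP[b0 b1]; elim: n => [|n IH].
  by rewrite !expr0 subrr normr0 mul0r.
rewrite [X in `|X|](_ : _ = a * (a ^+ n - b ^+ n) + (a - b) * b ^+ n);
  last by rewrite !exprS; ring.
rewrite -natr1 [leRHS]mulrDl mul1r; apply: (le_trans (ler_normD _ _)).
rewrite !normrM (ger0_norm a0) (ger0_norm (exprn_ge0 n b0)).
apply: lerD; first by apply: le_trans IH; rewrite ler_piMl.
by rewrite ler_piMr// exprn_ile1.
Qed.

(** Existence comes from the intermediate value theorem for [F q - q], nonnegative at 0 and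
    nonpositive at 1; [k < 1] then forces uniqueness. *)
Lemma contraction_itv01_fixpoint (F : R -> R) (k : R) : k < 1 ->
    (forall q, 0 <= q <= 1 -> 0 <= F q <= 1) ->
    (forall p q, 0 <= p <= 1 -> 0 <= q <= 1 -> `|F p - F q| <= k * `|p - q|) ->
  exists! q, 0 <= q <= 1 /\ q = F q.
Proof.
move=> k1 F01 Fk.
(* [F] is controlled on [[0, 1]] only; composing it with the projection onto [[0, 1]] gives a
   function continuous on the whole line. *)
pose clip : R -> R := (id \max cst 0) \min cst 1.
have clip01 x : 0 <= clip x <= 1.
  by rewrite /clip/= ge_min lexx orbT andbT le_min ler01 le_max lexx orbT.
have clip_id x : 0 <= x <= 1 -> clip x = x.
  by move=> /andP[x0 x1]; rewrite /clip/= (max_idPl x0) (min_idPl x1).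
have cF : continuous (F \o clip).
  have cclip : continuous clip.
    move=> x; apply: continuous_min; last exact: cvg_cst.
    by apply: continuous_max; [exact: cvg_id|exact: cvg_cst].
  move=> x; apply/cvgrPdist_lt => e e0.
  have /cvgrPdist_lt/(_ e e0) := cclip x; apply: filterS => y /=.
  apply: le_lt_trans; apply: (le_trans (Fk _ _ (clip01 x) (clip01 y))).
  by rewrite ler_piMl// ltW.
have [q q01 Fq] : exists2 q, q \in `[0, 1] & F (clip q) - q = 0.
  apply: (IVT (f := (F \o clip) - id)) => //.
    apply: continuous_subspaceT => x; apply: (@cvgB _ R^o); first exact: cF.
    exact: cvg_id.
  rewrite !fctE /= subr0 ge_min le_max.
  have /andP[F0 _] := F01 _ (clip01 0); have /andP[_ F1] := F01 _ (clip01 1).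
  by rewrite F0 subr_le0 F1 orbT.
exists q; rewrite in_itv/= in q01; split.
  by split => //; move: Fq; rewrite clip_id// => /eqP; rewrite subr_eq0 => /eqP.
move: Fq; rewrite clip_id// => /eqP; rewrite subr_eq0 => /eqP Fq r [r01 Fr].
apply/eqP; rewrite -subr_eq0 -normr_eq0 -[_ == 0]negbK; apply/negP => qr.
have := Fk _ _ q01 r01; rewrite Fq -Fr.
have : 0 < `|q - r| by rewrite lt_neqAle eq_sym qr normr_ge0.
nra.
Qed.

End fixed_point.

(** * Size and variation of the Gaussian coefficient under (H) *)

Section overlap.
Context {R : realType}.
Implicit Types beta q : R.

Definition overlap_scale (p : nat) beta q : R :=
  beta * (p%:R / 2) `^ 2^-1 * q `^ ((p%:R - 1) / 2).

(** Squaring clears the half-integer powers and leaves a polynomial in [q]. The scale itself need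
    not be Lipschitz at 0: for [p = 2] it is a multiple of the square root of [q]. *)
Lemma overlap_scale_sqr p beta q : (0 < p)%N -> 0 <= q ->
  overlap_scale p beta q ^+ 2 = beta ^+ 2 * (p%:R / 2) * q ^+ p.-1.
Proof.
move=> p0 q0; have p20 : 0 <= p%:R / 2 :> R by rewrite divr_ge0.
have sqrE (a x : R) : (a `^ x) ^+ 2 = a `^ (x * 2).
  by rewrite powRrM powR_mulrn// powR_ge0.
rewrite /overlap_scale !exprMn !sqrE mulVf ?pnatr_eq0// powRr1//.
by congr (_ * _); rewrite divfK ?pnatr_eq0// -powR_mulrn// -subn1 natrB//.
Qed.

(** The exponential in the threshold equation is at least 1, so [8 p^2 bp^2 <= 1/2], and
    [beta < bp]. *)
Lemma condition_H_sqr_lt p beta : (0 < p)%N -> condition_H p beta ->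
  beta ^+ 2 * p%:R ^+ 2 < 16^-1.
Proof.
move=> p0 [beta0 [bp [bp0 bpE] betabp]].
have p2 : 0 < p%:R ^+ 2 :> R by rewrite exprn_gt0// ltr0n.
have bp2 : beta ^+ 2 < bp ^+ 2 by rewrite ltr_pXn2r// nnegrE ltW.
have e1 : 1 <= expR (16 * bp ^+ 2 * p%:R).
  by rewrite -expR0 ler_expR mulr_ge0// mulr_ge0// sqr_ge0.
have le1 : 8 * p%:R ^+ 2 * bp ^+ 2 <= 2^-1.
  by rewrite -bpE ler_peMr// mulr_ge0 ?sqr_ge0// mulr_ge0// ltW.
have : beta ^+ 2 * p%:R ^+ 2 < bp ^+ 2 * p%:R ^+ 2 by rewrite ltr_pM2r.
lra.
Qed.

(** The power [p.-1] contributes a Lipschitz factor at most [p], so the constant is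
    [beta^2 p^2 / 2 < 1/32]. *)
Lemma overlap_scale_sqr_sub_le p beta a b : (0 < p)%N -> condition_H p beta ->
    0 <= a <= 1 -> 0 <= b <= 1 ->
  `|overlap_scale p beta a ^+ 2 - overlap_scale p beta b ^+ 2| <=
  32^-1 * `|a - b|.
Proof.
move=> p0 H a01 b01; have /andP[a0 _] := a01; have /andP[b0 _] := b01.
have bp := condition_H_sqr_lt p0 H.
rewrite !overlap_scale_sqr// -mulrBr normrM ger0_norm; last first.
  by rewrite mulr_ge0 ?sqr_ge0// divr_ge0.
have le_p : `|a ^+ p.-1 - b ^+ p.-1| <= p%:R * `|a - b|.
  by rewrite (le_trans (expr_sub_le _ a01 b01))// ler_wpM2r// ler_nat leq_pred.
apply: (@le_trans _ _ (beta ^+ 2 * (p%:R / 2) * (p%:R * `|a - b|))).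
  by rewrite ler_wpM2l// mulr_ge0 ?sqr_ge0// divr_ge0.
rewrite [leLHS](_ : _ = (beta ^+ 2 * p%:R ^+ 2) / 2 * `|a - b|); last by field.
by rewrite ler_wpM2r//; lra.
Qed.

(** Here [q ^+ p.-1] is only bounded by 1; the decay in [p] comes from
    [beta^2 p / 2 = (beta^2 p^2) / (2 p)]. *)
Lemma overlap_scale_sqr_le p beta q : (0 < p)%N -> condition_H p beta ->
  0 <= q <= 1 -> overlap_scale p beta q ^+ 2 <= 32^-1 * p%:R^-1.
Proof.
move=> p0 H /andP[q0 q1]; have := condition_H_sqr_lt p0 H.
have pR0 : 0 < p%:R :> R by rewrite ltr0n.
rewrite overlap_scale_sqr// ler_pdivlMr// => bp.
have q1n : q ^+ p.-1 <= 1 by rewrite exprn_ile1.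
have : beta ^+ 2 * p%:R ^+ 2 / 2 * q ^+ p.-1 <= beta ^+ 2 * p%:R ^+ 2 / 2.
  by rewrite ler_piMr// divr_ge0// mulr_ge0// sqr_ge0.
rewrite [X in _ -> X <= _](_ : _ = beta ^+ 2 * p%:R ^+ 2 / 2 * q ^+ p.-1).
  lra.
by field.
Qed.

End overlap.

Theorem proposition3p1 (R : realType) (d : measure_display)
    (T : measurableType d) (P : probability T R) (Y : {RV P >-> R})
    (hY : standard_gaussian Y) (h : R) (h_gt0 : 0 < h) :
  (forall (p : nat) (beta : R), (2 <= p)%N -> condition_H p beta ->
     exists! q : R, overlap_solution Y h p beta q) /\
  (forall beta q : nat -> R,
     (forall p : nat, (2 <= p)%N -> condition_H p (beta p)) ->
     (forall p : nat, (2 <= p)%N -> overlap_solution Y h p (beta p) (q p)) ->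
     q p @[p --> \oo] --> tanh h ^+ 2).
Proof.
pose F p beta q := gaussian_tanh_sqr Y h (overlap_scale p beta q).
have solE p beta q : overlap_solution Y h p beta q <->
    (0 <= q <= 1 /\ q = F p beta q).
  rewrite /overlap_solution expectation_tanh_sqr.
  by split=> -[q01]; [move=> [qE]|move=> qE]; split=> //; rewrite {1}qE.
split=> [p beta /ltnW p0 H|beta q H sol].
  have [q [qF qU]] : exists! q, 0 <= q <= 1 /\ q = F p beta q.
    (* The ratio is [24 / 32], from [gaussian_tanh_sqr_sub] and [overlap_scale_sqr_sub_le]. *)
    apply: (@contraction_itv01_fixpoint _ _ (3 / 4)) => [|q _|a b a01 b01].
    - by lra.
    - exact: gaussian_tanh_sqr_itv.
    - apply: (le_trans (gaussian_tanh_sqr_sub hY _ _ _)).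
      by have := overlap_scale_sqr_sub_le p0 H a01 b01; lra.
  by exists q; split=> [|r /solE/qU//]; apply/solE.
apply/cvgrPdist_le => e e0; near=> p.
have p2 : (2 <= p)%N by near: p; exists 2%N.
have p0 := ltnW p2.
have /solE[q01 ->] := sol p p2.
(* The limit is the expectation at coefficient 0, so the error is at most [24 / (32 p)] whatever
   [beta p] is, and [p >= 1 / e] suffices. *)
rewrite -(gaussian_tanh_sqr0 Y h) (le_trans (gaussian_tanh_sqr_sub hY _ _ _))//.
rewrite expr0n/= sub0r normrN ger0_norm ?sqr_ge0//.
have := overlap_scale_sqr_le p0 (H p p2) q01.
have : p%:R^-1 <= e.
  rewrite -[leRHS]invrK lef_pV2 ?posrE ?invr_gt0 ?ltr0n//.
  by near: p; exact: nbhs_infty_ger.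
lra.
Unshelve. all: by end_near. Qed.
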